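(* Let $1<p,q<\infty$ with $\frac1p+\frac1q=1$, let $M$ be a nonempty subset of $\mathbb{N}$ with complement $\bar{M}=\mathbb{N}\setminus M$, and let $r>0$. Let $r\mathbb{C}_M=\{x\in l_p:\|x_M\|_p\le r\}$, with interior $(r\mathbb{C}_M)^{o}$ and boundary $\partial(r\mathbb{C}_M)=\{x\in l_p:\|x_M\|_p=r\}$. The metric projection $P_{r\mathbb{C}_M}:l_p\to r\mathbb{C}_M$ has the following differentiability properties. (i) $P_{r\mathbb{C}_M}$ is strictly Fréchet differentiable on $(r\mathbb{C}_M)^{o}$, with $\nabla P_{r\mathbb{C}_M}(\bar{x})=I_{l_p}$ for every $\bar{x}\in(r\mathbb{C}_M)^{o}$; that is, $\nabla P_{r\mathbb{C}_M}(\bar{x})(u)=u$ for every $u\in l_p$. (ii) $P_{r\mathbb{C}_M}$ is Fréchet differentiable at every $\bar{x}\in l_p\setminus r\mathbb{C}_M$, with $$\nabla P_{r\mathbb{C}_M}(\bar{x})(u)=\frac{r}{\|\bar{x}_M\|_p}\left(u_M-\frac{\langle J(\bar{x}_M),u_M\rangle}{\|\bar{x}_M\|_p^2}\bar{x}_M\right)+u_{\bar{M}}\quad\text{for every }u\in l_p.$$ In particular, $\nabla P_{r\mathbb{C}_M}(\bar{x})(\bar{x})=\bar{x}_{\bar{M}}$ for every $\bar{x}\in l_p\setminus r\mathbb{C}_M$. (iii) On $\partial(r\mathbb{C}_M)$: (I) $P_{r\mathbb{C}_M}$ is Gâteaux directionally differentiable at every $\bar{x}\in\partial(r\mathbb{C}_M)$,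 and (a) $P'_{r\mathbb{C}_M}(\bar{x})(u)=u-\frac{\langle J(\bar{x}_M),u_M\rangle}{r^2}\bar{x}_M$ if $u\in\bar{x}_r^{\Uparrow}$; (b) $P'_{r\mathbb{C}_M}(\bar{x})(\bar{x})=\bar{x}_{\bar{M}}$; (c) $P'_{r\mathbb{C}_M}(\bar{x})(u)=u$ if $u\in\bar{x}_r^{\Downarrow}$. (II) $P_{r\mathbb{C}_M}$ is not Fréchet differentiable at any point $\bar{x}\in\partial(r\mathbb{C}_M)$.
   Context: $l_p$ is the real sequence space with norm $\|\cdot\|_p$, indexed by the positive integers $\mathbb{N}$, with dual $l_q$, pairing $\langle\cdot,\cdot\rangle$, and origin $\theta$. For $x\in l_p$, $x_M\in l_p$ has coordinates $(x_M)_i=x_i$ for $i\in M$ and $(x_M)_i=0$ for $i\notin M$; similarly $x_{\bar{M}}$ has coordinates $x_i$ for $i\in\bar{M}$ and $0$ otherwise, so $x=x_M+x_{\bar{M}}$. The normalized duality mapping $J:l_p\to l_q$ is $J(x)=\left(\frac{|x_i|^{p-1}\mathrm{sign}(x_i)}{\|x\|_p^{p-2}}\right)_{i\in\mathbb{N}}$ for $x\ne\theta$, and $J(\theta)=\theta$. For a nonempty closed convex $C\subseteq l_p$, the metric projection $P_C:l_p\to C$ sends $x$ to the unique point of $C$ nearest to $x$ in $\|\cdot\|_p$. Differentiability notions: - Gâteaux directional derivative at $x$ along $v\ne\theta$: $P'_C(x)(v)=\lim_{t\downarrow 0}\frac{P_C(x+tv)-P_C(x)}{t}$, when the limit exists;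 $P_C$ is Gâteaux directionally differentiable at $x$ if it exists for every $v\neq\theta$. - $P_C$ is Fréchet differentiable at $\bar{x}$ if there is a continuous linear map $\nabla P_C(\bar{x}):l_p\to l_p$ with $\lim_{x\to\bar{x}}\frac{P_C(x)-P_C(\bar{x})-\nabla P_C(\bar{x})(x-\bar{x})}{\|x-\bar{x}\|_p}=\theta$. - It is strictly Fréchet differentiable at $\bar{x}$ if $\lim_{(u,v)\to(\bar{x},\bar{x})}\frac{P_C(u)-P_C(v)-\nabla P_C(\bar{x})(u-v)}{\|u-v\|_p}=\theta$ (over $u\ne v$) for some continuous linear map $\nabla P_C(\bar{x})$. For $x\in l_p$ with $\|x_M\|_p=r$: $x_r^{\Uparrow}=\{v\in l_p:\exists\,\delta>0,\ \|(x+tv)_M\|_p>r\ \text{for all }t\in(0,\delta)\}$ and $x_r^{\Downarrow}=\{v\in l_p:\exists\,\delta>0,\ \|(x+tv)_M\|_p\le r\ \text{for all }t\in(0,\delta)\}$. *)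

(* Defs.v *)
From HB Require Import structures.
From mathcomp Require Import all_boot all_order all_algebra.
From mathcomp Require Import all_classical all_reals all_analysis.

Set Implicit Arguments.
Unset Strict Implicit.
Unset Printing Implicit Defensive.

Import Order.TTheory GRing.Theory Num.Theory.
Import numFieldNormedType.Exports.

Local Open Scope classical_set_scope.
Local Open Scope ring_scope.

Section Differentiability.
Context {R : realType} {V W : normedModType R}.
Implicit Types (f : V -> W) (x v : V).

(* Frechet differentiability is the library's [differentiable] and ['d f x];
   the library has neither the strict version nor one-sided directional
   derivatives. *)

Definition strict_diff_at f x (D : {linear V -> W}) : Prop :=
  continuous D /\
  `|z.1 - z.2|^-1 *: (f z.1 - f z.2 - D (z.1 - z.2))
    @[z --> within [set z : V * V | z.1 <> z.2] (nbhs (x, x))] --> (0 : W).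

Definition gateaux_quotient f x v (t : R) : W := t^-1 *: (f (x + t *: v) - f x).

Definition gateaux_derivable f x v : Prop :=
  cvg (gateaux_quotient f x v t @[t --> 0^'+]).

Definition gateaux_derive f x v : W :=
  lim (gateaux_quotient f x v t @[t --> 0^'+]).

Definition gateaux_differentiable f x : Prop :=
  forall v, v <> 0 -> gateaux_derivable f x v.

End Differentiability.

Section Projection.
Context {R : realType} {V : normedModType R}.

Definition nearest (C : set V) (x : V) : set V :=
  [set y | C y /\ forall z, C z -> `|x - y| <= `|x - z|].

(* The default value [0] is taken when there is no, or more than one, nearest
   point. *)
Definition metric_proj (C : set V) (x : V) : V :=
  xget 0 [set y | unique (nearest C x) y].

Definition boundary (C : set V) : set V := closure C `\` interior C.

End Projection.

Section SequenceSpace.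
Context {R : realType}.

Lemma exponent_ge1 (p : R) : 1 < p -> (1 <= p%:E)%E.
Proof. by move=> p1; rewrite lee_fin ltW. Qed.

(* The underlying space [LfunType] is not quotiented by a.e. equality; for the
   counting measure on [nat] only the empty set is negligible, so equality is
   equality of sequences. Coordinates are numbered from 0, not from 1. *)
Definition lp (p : R) (hp : 1 < p) : Type :=
  LfunType (@counting nat R) (exponent_ge1 hp).

Section Norm.
Context (p : R) (hp : 1 < p).

HB.instance Definition _ := GRing.Lmodule.on (lp hp).

Definition lp_coord (x : lp hp) : nat -> R :=
  (x : LfunType (@counting nat R) (exponent_ge1 hp)).

Lemma lp_ext (x y : lp hp) : lp_coord x =1 lp_coord y -> x = y.
Proof. by move=> xy; apply/LfuneqP. Qed.

Lemma lp_coordD (x y : lp hp) i :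
  lp_coord (x + y) i = lp_coord x i + lp_coord y i.
Proof. by []. Qed.

Lemma lp_coordZ (a : R) (x : lp hp) i : lp_coord (a *: x) i = a * lp_coord x i.
Proof. by []. Qed.

Lemma lp_coord0 i : lp_coord (0 : lp hp) i = 0.
Proof. by []. Qed.

Definition lpnorm (x : lp hp) : R :=
  fine ('N[@counting nat R]_(p%:E)[EFin \o lp_coord x])%E.

Lemma lpnormD (x y : lp hp) : lpnorm (x + y) <= lpnorm x + lpnorm y.
Proof. exact: ler_LnormD. Qed.

Lemma lpnormZ (a : R) (x : lp hp) : lpnorm (a *: x) = `|a| * lpnorm x.
Proof. by apply: EFin_inj; rewrite EFinM /lpnorm !finite_norm_fine -LnormZ. Qed.

Lemma Lnorm_coordE (f : nat -> R) :
  ('N[@counting nat R]_(p%:E)[EFin \o f] =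
   (\sum_(k <oo) (`|f k| `^ p)%:E) `^ p^-1)%E.
Proof.
have p_gt0 : 0 < p by exact: lt_trans hp.
by rewrite Lnorm_counting//; congr (_ `^ _)%E.
Qed.

Lemma lp_summable (x : lp hp) :
  (\sum_(k <oo) (`|lp_coord x k| `^ p)%:E < +oo)%E.
Proof.
have p_gt0 : 0 < p by exact: lt_trans hp.
have := @Lfunction_finite _ _ _ _ _ (exponent_ge1 hp) x.
rewrite /finite_norm Lnorm_coordE.
by apply: lty_poweRy; rewrite invr_eq0 gt_eqF.
Qed.

Lemma lpnorm0_eq0 (x : lp hp) : lpnorm x = 0 -> x = 0.
Proof.
move=> x0; apply: lp_ext => i; rewrite lp_coord0.
have S0 : (\sum_(k <oo) (`|lp_coord x k| `^ p)%:E = 0)%E.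
  apply/(@poweR_eq0_eq0 _ _ p^-1).
    by apply: nneseries_ge0 => k _ _; rewrite lee_fin powR_ge0.
  rewrite -Lnorm_coordE -[RHS]/(0%:E) -x0 /lpnorm.
  by rewrite finite_norm_fine.
have xi0 : `|lp_coord x i| `^ p = 0.
  apply/eqP; rewrite eq_le powR_ge0 andbT -lee_fin.
  rewrite -[leRHS]/(0%E) -S0 (@nneseriesD1 _ _ i xpredT)//.
  rewrite leeDl//.
  by apply: nneseries_ge0 => k _ _; rewrite lee_fin powR_ge0.
exact/normr0_eq0/(powR_eq0_eq0 xi0).
Qed.

HB.instance Definition _ :=
  Lmodule_isNormed.Build R (lp hp) lpnormD lpnormZ lpnorm0_eq0.

Lemma lpnormE (x : lp hp) :
  `|x| = (fine (\sum_(k <oo) (`|lp_coord x k| `^ p)%:E)%E) `^ p^-1.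
Proof. by rewrite -[LHS]/(lpnorm x) /lpnorm Lnorm_coordE fine_poweR. Qed.

Lemma summable_Lfun (f : nat -> R) :
  (\sum_(k <oo) (`|f k| `^ p)%:E < +oo)%E ->
  f \in Lfun (@counting nat R) p%:E.
Proof.
move=> fp; apply/andP; split; rewrite inE/=.
  by move=> _ Y _; exact: I.
by rewrite /finite_norm Lnorm_coordE poweR_lty.
Qed.

Definition mk_lp (f : nat -> R)
    (fp : (\sum_(k <oo) (`|f k| `^ p)%:E < +oo)%E) : lp hp :=
  Lfun_Sub (exponent_ge1 hp) (summable_Lfun fp).

Lemma lp_coord_mk_lp (f : nat -> R) fp i : lp_coord (@mk_lp f fp) i = f i.
Proof. by []. Qed.

Lemma restr_summable (M : set nat) (x : lp hp) :
  (\sum_(k <oo) (`|(lp_coord x \_ M) k| `^ p)%:E < +oo)%E.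
Proof.
have p_gt0 : 0 < p by exact: lt_trans hp.
apply: le_lt_trans (lp_summable x); apply: lee_nneseries => [k _ _|k _].
  by rewrite lee_fin powR_ge0.
rewrite lee_fin patchE; case: ifP => // _.
by rewrite normr0 powR0 ?powR_ge0// gt_eqF.
Qed.

Definition restr (M : set nat) (x : lp hp) : lp hp :=
  mk_lp (restr_summable M x).

Definition cyl (M : set nat) (r : R) : set (lp hp) :=
  [set x | `|restr M x| <= r].

Definition up_dirs (M : set nat) (r : R) (x : lp hp) : set (lp hp) :=
  [set v | exists2 d : R, 0 < d &
    forall t : R, 0 < t < d -> r < `|restr M (x + t *: v)|].

Definition down_dirs (M : set nat) (r : R) (x : lp hp) : set (lp hp) :=
  [set v | exists2 d : R, 0 < d &
    forall t : R, 0 < t < d -> `|restr M (x + t *: v)| <= r].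

End Norm.

Section Duality.
Context (p q : R) (hp : 1 < p) (hq : 1 < q) (hpq : p^-1 + q^-1 = 1).

Definition pairing (y : lp hq) (x : lp hp) : R :=
  limn (series (fun i => lp_coord y i * lp_coord x i)).

(* At [x = 0] every coordinate vanishes because [Num.sg 0 = 0], so no case
   distinction is needed: see [J0]. *)
Definition J_seq (x : lp hp) (i : nat) : R :=
  `|lp_coord x i| `^ (p - 1) * Num.sg (lp_coord x i) / `|x| `^ (p - 2).

Lemma J_summable (x : lp hp) :
  (\sum_(k <oo) (`|J_seq x k| `^ q)%:E < +oo)%E.
Proof.
have p0 : 0 < p by exact: lt_trans hp.
have q0 : 0 < q by exact: lt_trans hq.
have pq : (p - 1) * q = p.
  have -> : p = q / (q - 1).
    have q1 : q - 1 != 0 by rewrite subr_eq0 gt_eqF.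
    have e : p^-1 = (q - 1) / q.
      by rewrite mulrBl divff ?gt_eqF// mul1r -hpq addrK.
    by rewrite -[p]invrK e invf_div.
  have q1 : q - 1 != 0 by rewrite subr_eq0 gt_eqF.
  by rewrite -[X in _ - X](divff q1) -mulrBl opprB addrC subrK mul1r mulrC.
pose c := (`|x| `^ (p - 2))^-1 `^ q.
have JE k : `|J_seq x k| `^ q = c * `|lp_coord x k| `^ p.
  rewrite /J_seq !normrM normfV !(ger0_norm (powR_ge0 _ _)) normr_sg.
  rewrite powRM ?mulr_ge0 ?powR_ge0 ?invr_ge0 ?powR_ge0//.
  rewrite mulrC; congr (_ * _).
  have [->|xk0] := eqVneq (lp_coord x k) 0.
    by rewrite mulr0 normr0 !powR0 ?gt_eqF.
  by rewrite mulr1 -powRrM pq.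
under eq_eseriesr do rewrite JE EFinM.
rewrite nneseriesZl//.
by rewrite lte_mul_pinfty ?lee_fin ?powR_ge0// lp_summable.
Qed.

Definition J (x : lp hp) : lp hq := mk_lp hq (J_summable x).

Lemma J0 : J 0 = 0.
Proof.
apply: lp_ext => i.
by rewrite lp_coord_mk_lp lp_coord0 /J_seq lp_coord0 sgr0 mulr0 mul0r.
Qed.

End Duality.
End SequenceSpace.

(* Main.v *)
(* The projection onto the cylinder is the identity on the cylinder and the
   radial retraction [x |-> (r / |x_M|) x_M + x_{~M}] outside; nearest points
   are unique because the l_p norm is strictly convex. So everything reduces to
   the Frechet derivative of the norm at [x != 0], whose value is pairing with
   [J x / |x|]: this vector is a subgradient, and it depends continuously on [x]
   because the map [x |-> |x_i|^(p-1) sign x_i] from l_p to l_q is continuous.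
   On the boundary, the direction [x] sees the retraction while [- x] sees the
   identity, and the two one-sided derivatives are incompatible with linearity
   since [x_M != 0]. *)
Require Import Defs.
From HB Require Import structures.
From mathcomp Require Import all_boot all_order all_algebra.
From mathcomp Require Import all_classical all_reals all_analysis.
From mathcomp Require Import ring lra.

Set Implicit Arguments.
Unset Strict Implicit.
Unset Printing Implicit Defensive.

Import Order.TTheory GRing.Theory Num.Theory.
Import numFieldNormedType.Exports.

Local Open Scope classical_set_scope.
Local Open Scope ring_scope.

(** * Powers of absolute values *)

Section PowerFunction.
Context {R : realType}.
Implicit Types a b p q : R.

Lemma powR_continuous p a : 0 < a -> {for a, continuous (@powR R ^~ p)}.
Proof.
move=> a0; have [/derivable1_diffP da _] := is_derive1_powR p a0.
exact: differentiable_continuous.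
Qed.

Lemma ler_powRl p a b : 0 <= p -> 0 <= a -> a <= b -> a `^ p <= b `^ p.
Proof.
by move=> p0 a0 ab; apply: ge0_ler_powR; rewrite ?nnegrE// (le_trans a0).
Qed.

Lemma powR_ge1 p a : 0 <= p -> 1 <= a -> 1 <= a `^ p.
Proof. by move=> p0 a1; rewrite (_ : 1 = 1 `^ p) ?ler_powRl// powR1. Qed.

Lemma powRVK p a : p != 0 -> 0 <= a -> (a `^ p^-1) `^ p = a.
Proof. by move=> p0 a0; rewrite -powRrM mulVf// powRr1. Qed.

(** Strict convexity through the mean value theorem on the two halves of [[a, b]]: they have equal
    length, and the derivative [p * c ^ (p - 1)] is strictly larger at the intermediate point of the
    right half. *)
Lemma powR_midpoint_pos p a b : 1 < p -> 0 <= a -> a < b ->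
  ((a + b) / 2) `^ p < (a `^ p + b `^ p) / 2.
Proof.
move=> p1 a0 ab; set m := (a + b) / 2.
have p0 : 0 < p by lra.
have am : a < m by rewrite /m; lra.
have mb : m < b by rewrite /m; lra.
have m0 : 0 < m by lra.
have pow_cont u v : 0 <= u -> {within `[u, v], continuous (@powR R ^~ p)}.
  move=> u0.
  have : {within `[0, +oo[, continuous (@powR R ^~ p)}.
    apply/continuous_within_itvcyP; split => [z|].
      by rewrite in_itv/= andbT => z0; exact: powR_continuous.
    by rewrite powR0 ?gt_eqF//; exact: powR_cvg0.
  apply: continuous_subspaceW => z /=.
  by rewrite !in_itv/= => /andP[uz _]; rewrite andbT (le_trans u0).
have mvt u v : 0 <= u -> u < v ->
    exists2 c, u < c < v & v `^ p - u `^ p = p * c `^ (p - 1) * (v - u).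
  move=> u0 uv.
  have [x|c] := @MVT R (@powR R ^~ p) (fun x => p * x `^ (p - 1)) u v uv _
      (pow_cont _ _ u0); last by rewrite in_itv/=; exists c.
  rewrite in_itv/= => /andP[ux _].
  exact: is_derive1_powR (le_lt_trans u0 ux).
have [c1 /andP[ac1 c1m] E1] := mvt _ _ a0 am.
have [c2 /andP[mc2 c2b] E2] := mvt _ _ (ltW m0) mb.
have c12 : c1 `^ (p - 1) < c2 `^ (p - 1).
  by rewrite gt0_ltr_powR ?subr_gt0 ?nnegrE; lra.
have : p * c1 `^ (p - 1) * (m - a) < p * c2 `^ (p - 1) * (b - m).
  have -> : b - m = m - a by rewrite /m; lra.
  by rewrite ltr_pM2r ?subr_gt0// ltr_pM2l.
by rewrite -E1 -E2; lra.
Qed.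

(** If [|a|] and [|b|] differ, the triangle inequality reduces to nonnegative reals. Otherwise
    [b = - a]: the midpoint is [0], while the right-hand side is positive. *)
Lemma powR_midpoint_norm p a b : 1 < p -> a != b ->
  `|(a + b) / 2| `^ p < (`|a| `^ p + `|b| `^ p) / 2.
Proof.
move=> p1 ab; have p0 : 0 < p by lra.
have mono u v : `|u| < `|v| ->
    `|(u + v) / 2| `^ p < (`|u| `^ p + `|v| `^ p) / 2.
  move=> uv; apply: le_lt_trans (powR_midpoint_pos p1 _ uv) => //.
  apply: ler_powRl; rewrite ?(ltW p0)//.
  rewrite normrM [`|2^-1|]gtr0_norm ?invr_gt0// ler_pM2r ?invr_gt0//.
  exact: ler_normD.
have [|/mono//|ba] := ltgtP `|b| `|a|.
- by move=> /mono; rewrite addrC [in X in _ < X]addrC.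
- have b0 : b = - a.
    by move/eqP: ba; rewrite eqr_norm2 eq_sym (negPf ab)/= => /eqP.
  rewrite b0 normrN subrr mul0r normr0 powR0 ?gt_eqF//.
  have a0 : 0 < `|a|.
    by rewrite normr_gt0; apply: contraNneq ab => a0; rewrite b0 a0 oppr0.
  by have := powR_gt0 p a0; lra.
Qed.

(** The odd extension of the power function; for [s = p - 1] it is the numerator of a coordinate of
    [J]. *)
Definition sgpow s a := `|a| `^ s * Num.sg a.

Lemma sgpowM s a b : sgpow s (a * b) = sgpow s a * sgpow s b.
Proof. by rewrite /sgpow normrM powRM// sgrM mulrACA. Qed.

Lemma norm_sgpow s a : s != 0 -> `|sgpow s a| = `|a| `^ s.
Proof.
move=> s0; rewrite /sgpow normrM (ger0_norm (powR_ge0 _ _)) normr_sg.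
by have [->|a0] := eqVneq a 0; rewrite ?mulr1// normr0 powR0// mul0r.
Qed.

(** This identity makes the [q]-th power of [|sgpow (p - 1) a|] equal to the [p]-th power of [|a|],
    which is how l_p is carried into l_q. *)
Lemma conjugate_exponentM p q : 1 < p -> p^-1 + q^-1 = 1 -> (p - 1) * q = p.
Proof.
move=> p1 pq.
(* By the convention that the inverse of [0] is [0], [q = 0] would force [p = 1]. *)
have q0 : q != 0.
  apply/eqP => q0; move: pq; rewrite q0 invr0 addr0 => /(congr1 GRing.inv).
  by rewrite invrK invr1 => pE; rewrite pE ltxx in p1.
have p0 : p != 0 by rewrite gt_eqF//; lra.
have : p * q * (p^-1 + q^-1) = p * q by rewrite pq mulr1.
rewrite mulrDr mulrAC divff// mul1r -mulrA divff// mulr1 => e.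
by rewrite mulrBl mul1r -e addrAC subrr add0r.
Qed.

(* By homogeneity it suffices to treat [a = 1]: near [b = 1] use continuity,
   and away from [1] both [1] and [`|b|] are at most a multiple of
   [`|b - 1|]. *)
Lemma sgpow_sub_le p q (e : R) : 1 < p -> 1 < q -> p^-1 + q^-1 = 1 -> 0 < e ->
  exists2 C : R, 0 < C & forall a b,
    `|sgpow (p - 1) b - sgpow (p - 1) a| `^ q <=
    e * `|a| `^ p + C * `|b - a| `^ p.
Proof.
move=> p1 q1 pq e0.
have p0 : 0 < p by lra.
have q0 : 0 < q by lra.
have pB1 : p - 1 != 0 by rewrite gt_eqF// subr_gt0.
have pq' : (p - 1) * q = p by exact: conjugate_exponentM.
have : \forall t \near (1 : R), `|sgpow (p - 1) t - 1| < e `^ q^-1.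
  have : t `^ (p - 1) @[t --> (1:R)] --> (1 : R).
    rewrite [X in _ --> X](_ : _ = (1 : R) `^ (p - 1)); last by rewrite powR1.
    exact: powR_continuous.
  move/cvgrPdist_lt => /(_ _ (powR_gt0 q^-1 e0)) h.
  near=> t; have t0 : 0 < t by near: t; exact: lt_nbhsr.
  rewrite /sgpow (gtr0_norm t0) (gtr0_sg t0) mulr1 distrC; near: t; exact: h.
move=> /nbhs_ballP[d /= d0 hd].
(* Chosen so that [d <= s] gives both [1 <= D * s] and [1 + s <= D * s]; it is applied to
   [s = |t - 1|]. *)
pose D := d^-1 + 1.
have D0 : 0 < D by rewrite addr_gt0 ?invr_gt0.
have D1 : 1 <= D by rewrite lerDr invr_ge0 ltW.
(* The constant that appears when [2 * (D * s) ^ (p - 1)] is raised to the power [q]. *)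
pose C := 2 `^ q * D `^ p.
have C1 : 1 <= C.
  by apply: mulr_ege1; rewrite powR_ge1 ?(ltW q0) ?(ltW p0) ?ler1n.
have C0 : 0 <= C by exact: le_trans ler01 C1.
have base t : `|sgpow (p - 1) t - 1| `^ q <= e + C * `|t - 1| `^ p.
  have [td|dt] := ltP `|t - 1| d.
    apply: (@le_trans _ _ e); last by rewrite lerDl mulr_ge0 ?powR_ge0.
    have : `|sgpow (p - 1) t - 1| < e `^ q^-1.
      by apply: hd; rewrite /ball/= distrC.
    move=> /ltW /(ler_powRl (ltW q0) (normr_ge0 _)) /le_trans; apply.
    by rewrite powRVK ?gt_eqF ?(ltW e0).
  set s := `|t - 1| in dt *.
  have s0 : 0 < s by exact: lt_le_trans d0 dt.
  have s1 : 1 <= D * s.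
    apply: (@le_trans _ _ (d^-1 * s)).
      by rewrite mulrC ler_pdivlMr// mul1r.
    by rewrite ler_pM2r// /D lerDl.
  have ts : `|t| <= D * s.
    apply: (@le_trans _ _ (1 + s)).
      rewrite -[X in `|X| <= _](subrKC 1).
      by rewrite (le_trans (ler_normD _ _))// normr1.
    by rewrite /D mulrDl mul1r lerD2r mulrC ler_pdivlMr// mul1r.
  have Ds0 : 0 <= D * s by lra.
  have h : `|sgpow (p - 1) t - 1| <= 2 * (D * s) `^ (p - 1).
    rewrite (le_trans (ler_normB _ _))// norm_sgpow// normr1.
    rewrite mulr2n mulrDl mul1r.
    apply: lerD; last by rewrite powR_ge1// subr_ge0 ltW.
    by rewrite ler_powRl// subr_ge0 ltW.
  apply: (@le_trans _ _ (C * s `^ p)); last by rewrite lerDr ltW.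
  have -> : C * s `^ p = (2 * (D * s) `^ (p - 1)) `^ q.
    by rewrite powRM ?powR_ge0// -powRrM pq' powRM ?ltW// mulrA.
  by rewrite ler_powRl// ltW.
exists C; first by lra.
(* Scaling by [a] is impossible when [a = 0]; there the left-hand side is the [p]-th power of [|b|],
   and [C1] suffices. *)
move=> a b; have [->|a0] := eqVneq a 0.
  rewrite /sgpow normr0 sgr0 mulr0 !subr0 powR0 ?gt_eqF// mulr0 add0r.
  rewrite -/(sgpow _ _) norm_sgpow// -powRrM pq'.
  by rewrite ler_peMl ?powR_ge0.
have -> : b = a * (b / a) by rewrite mulrC divfK.
set t := b / a; rewrite sgpowM.
have -> : sgpow (p - 1) a * sgpow (p - 1) t - sgpow (p - 1) a =
    sgpow (p - 1) a * (sgpow (p - 1) t - 1) by ring.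
have -> : a * t - a = a * (t - 1) by ring.
rewrite (normrM (sgpow _ _)) (normrM a) norm_sgpow//.
rewrite !powRM ?powR_ge0// -powRrM pq'.
by rewrite mulrCA (mulrC e) -mulrDr ler_wpM2l ?powR_ge0.
Unshelve. all: by end_near. Qed.

End PowerFunction.

(** * Differentiability in normed spaces *)

Section Criteria.
Context {R : realType} {V W : normedModType R}.

(** Turns an explicit epsilon-delta estimate into the little-o definition; uniqueness of the
    differential then identifies it with [df]. *)
Lemma is_diff_norm_le (f : V -> W) (df : {linear V -> W}) (x : V) :
  continuous df ->
  (forall e, 0 < e -> exists2 d, 0 < d &
    forall y, `|y - x| < d -> `|f y - f x - df (y - x)| <= e * `|y - x|) ->
  is_diff x f df.
Proof.
move=> dfc fdf.
have E : f \o shift x = cst (f x) + df +o_ 0 id.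
  apply/eqaddoP => e e0; have [d d0 fd] := fdf e e0.
  near=> h; rewrite /= !fctE/= opprD addrA.
  have : `|h + x - x| < d.
    by rewrite addrK; near: h; exact: nbhs0_lt.
  by move=> /fd; rewrite addrK.
have dE := diff_unique dfc E; split => //.
by apply/diff_locallyP; rewrite dE.
Unshelve. all: by end_near. Qed.

Lemma diff_norm_le (f : V -> W) (x : V) : differentiable f x ->
  forall e, 0 < e -> exists2 d, 0 < d &
    forall y, `|y - x| < d -> `|f y - f x - 'd f x (y - x)| <= e * `|y - x|.
Proof.
move=> /diff_locallyP[_ /eqaddoP fE] e e0.
have /nbhs_ballP[d /= d0 hd] := fE e e0.
exists d => // y yd; have := hd (y - x).
rewrite -ball_normE/= sub0r normrN => /(_ yd).
by rewrite /= !fctE/= subrK opprD addrA.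
Qed.

Lemma near_eq_is_diff (f g : V -> W) (dg : V -> W) (x : V) :
  (\forall y \near x, f y = g y) -> is_diff x g dg -> is_diff x f dg.
Proof.
move=> /nbhs_ballP[d /= d0 fg] [dg_ex dgE].
have fgx y : `|y - x| < d -> f y = g y.
  by move=> yd; apply: fg; rewrite -ball_normE/= distrC.
have H : is_diff x f ('d g x).
  apply: is_diff_norm_le; first exact: diff_continuous.
  move=> e e0; have [d' d'0 gd] := diff_norm_le dg_ex e0.
  exists (Num.min d d'); first by rewrite lt_min d0.
  move=> y; rewrite lt_min => /andP[yd yd'].
  by rewrite !fgx ?subrr ?normr0//; exact: gd.
by case: H => fx fE; split; [exact: fx|exact: etrans fE dgE].
Qed.

(** Product rule: scaling is a continuous bilinear map on [R * W], and the chain rule is applied to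
    [y |-> (k y, g y)]. *)
Lemma is_diff_scale (k dk : V -> R) (g dg : V -> W) (x : V) :
  is_diff x k dk -> is_diff x g dg ->
  is_diff x (fun y => k y *: g y) (fun u => k x *: dg u + dk u *: g x).
Proof.
have bil : bilinear_for (GRing.Scale.Law.clone _ _ *:%R _)
    (GRing.Scale.Law.clone _ _ *:%R _) (@GRing.scale R W).
  split=> [u'|u] a b c /=; first by rewrite scalerDl scalerA.
  by rewrite scalerDr !scalerA mulrC.
pose s : {bilinear R -> W -> W} := HB.pack (@GRing.scale R W)
  (bilinear_isBilinear.Build R R W W _ _ (@GRing.scale R W) bil).
move=> dkx dgx.
have sc : continuous (fun z : R * W => s z.1 z.2).
  by move=> z; exact: scale_continuous.
have ds z : is_diff z (fun z : R * W => s z.1 z.2)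
    (fun h => s z.1 h.2 + s h.1 z.2).
  by apply: DiffDef; [exact: differentiable_bilin|rewrite diff_bilin].
exact: (@is_diff_comp _ _ _ _ (fun y => (k y, g y)) _ _ _ x).
Qed.

Lemma gateaux_quotient_cvg (f : V -> W) (x v : V) : differentiable f x ->
  gateaux_quotient f x v t @[t --> 0^'+] --> 'd f x v.
Proof.
move=> fx; apply/cvgrPdist_le => e e0.
(* The [+ 1] keeps the divisor positive when [v = 0]. *)
have v1 : 0 < `|v| + 1 by rewrite ltr_wpDl.
have [d d0 fd] := diff_norm_le fx (divr_gt0 e0 v1).
near=> t.
have t0 : 0 < t by near: t; exact: nbhs_right_gt.
have xtv : x + t *: v - x = t *: v by rewrite addrC addKr.
have tv : `|x + t *: v - x| < d.
  rewrite xtv normrZ gtr0_norm//.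
  apply: (@le_lt_trans _ _ (t * (`|v| + 1))); first by rewrite ler_pM2l// lerDl.
  by rewrite -ltr_pdivlMr//; near: t; apply: nbhs_right_lt; rewrite divr_gt0.
have := fd _ tv; rewrite xtv linearZ/= normrZ (gtr0_norm t0) => h.
rewrite distrC /gateaux_quotient.
rewrite -[X in _ - X](scalerK (lt0r_neq0 t0)) -scalerBr.
rewrite normrZ normfV (gtr0_norm t0).
rewrite ler_pdivrMl// (le_trans h)// mulrC -mulrA ler_pM2l//.
by rewrite mulrC -mulrA ger_pMr// mulrC ler_pdivrMr// mul1r lerDl.
Unshelve. all: by end_near. Qed.

Lemma norm_lt_continuous (f : V -> W) (x : V) :
  (forall e, 0 < e -> exists2 d, 0 < d &
    forall y, `|y - x| < d -> `|f y - f x| < e) ->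
  {for x, continuous f}.
Proof.
move=> fx; apply/cvgrPdist_lt => e /fx[d d0 fd].
near=> y; rewrite distrC fd// distrC; near: y; exact: cvgr_dist_lt.
Unshelve. all: by end_near. Qed.

Lemma continuous_norm_lt (f : V -> W) (x : V) : {for x, continuous f} ->
  forall e, 0 < e -> exists2 d, 0 < d &
    forall y, `|y - x| < d -> `|f y - f x| < e.
Proof.
move=> /cvgrPdist_lt fx e /fx /nbhs_ballP[d /= d0 fd]; exists d => // y yd.
by rewrite distrC; apply: fd; rewrite -ball_normE/= distrC.
Qed.

Lemma continuous_scale (k : V -> R) (f : V -> W) (x : V) :
  {for x, continuous k} -> {for x, continuous f} ->
  {for x, continuous (fun y => k y *: f y)}.
Proof. by move=> kx fx; exact: cvgZ. Qed.

End Criteria.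

Lemma lipschitz_linear_continuous (R : realType) (V W : normedModType R)
    (f : {linear V -> W}) (C : R) :
  (forall x, `|f x| <= C * `|x|) -> continuous f.
Proof.
move=> fC; apply/linear_bounded_continuous/linear_boundedP.
near=> r => x; apply: le_trans (fC x) _; apply: ler_wpM2r => //.
Unshelve. all: by end_near. Qed.

Section NormedSpace.
Context {R : realType} {V W : normedModType R}.

Lemma near_norm_lt (A : set V) (x : V) :
  (\forall y \near x, A y) <->
  exists2 d : R, 0 < d & forall y, `|y - x| < d -> A y.
Proof.
split=> [/nbhs_ballP[d /= d0 xA]|[d d0 xA]].
  by exists d => // y yd; apply: xA; rewrite -ball_normE/= distrC.
apply/nbhs_ballP; exists d => // y; rewrite -ball_normE/= distrC; exact: xA.
Qed.

Section Sublevel.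
Variables (N : V -> R) (r : R).
Hypotheses (N_cont : continuous N) (r0 : 0 < r)
  (NZ : forall a x, 0 <= a -> N (a *: x) = a * N x).

(** A point with [N x = r] is not interior, because a slight outward scaling [(1 + a) *: x] stays
    close to [x] but raises [N] above [r]. *)
Lemma interior_sublevel : interior [set x | N x <= r] = [set x | N x < r].
Proof.
apply/seteqP; split => [x xN|x xr].
  have /= := interior_subset xN; rewrite le_eqVlt => /orP[/eqP Nxr|//].
  have /near_norm_lt[d d0 hd] := xN.
  (* Small enough for [a * |x| < d], including when [x = 0]. *)
  pose a := d / (`|x| + 1) / 2.
  have x1 : 0 < `|x| + 1 by rewrite ltr_wpDl.
  have a0 : 0 < a by rewrite !divr_gt0.
  have : N ((1 + a) *: x) <= r.
    apply: hd; rewrite scalerDl scale1r addrAC subrr add0r normrZ gtr0_norm//.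
    apply: (@le_lt_trans _ _ (a * (`|x| + 1))).
      by rewrite ler_pM2l// lerDl.
    by rewrite /a mulrAC divfK ?gt_eqF// ltr_pdivrMr// ltr_pMr// ltr1n.
  rewrite NZ ?addr_ge0 ?(ltW a0)// Nxr mulrDl mul1r gerDl leNgt.
  by rewrite mulr_gt0.
have : open [set y | N y < r].
  apply: (@open_comp _ _ N [set t | t < r]); last exact: open_lt.
  by move=> y _; exact: N_cont.
rewrite openE => /(_ _ xr); apply: filterS => y; exact: ltW.
Qed.

Lemma boundary_sublevel : boundary [set x | N x <= r] = [set x | N x = r].
Proof.
have cl : closed [set x | N x <= r].
  apply: (@closed_comp _ _ N [set t | t <= r]); last exact: closed_le.
  by move=> y _; exact: N_cont.
rewrite /boundary interior_sublevel -((closure_id _).1 cl).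
apply/seteqP; split => [x [/= xr /negP]|x /= ->]; last by rewrite lexx ltxx.
by rewrite -leNgt => rx; apply/le_anti; rewrite xr.
Qed.

End Sublevel.

(** When both arguments are close to [x] the numerator of the strict quotient vanishes
    identically. *)
Lemma near_id_strict_diff (f : V -> V) (x : V) :
  (\forall y \near x, f y = y) -> strict_diff_at f x (idfun : {linear V -> V}).
Proof.
move=> fx; split; first by move=> y; exact: cvg_id.
apply: cvg_near_cst; rewrite near_withinE.
have fxx : \forall z \near (x, x), f z.1 = z.1 /\ f z.2 = z.2.
  exists ([set y | f y = y], [set y | f y = y]) => //=.
apply: filterS fxx => z [-> ->] _.
by rewrite subrr scaler0.
Qed.

(** Agreement is asked only along a short ray, since at a boundary point of the cylinder no single
    formula describes the projection on a whole neighbourhood. *)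
Lemma near_gateaux_quotient (f g : V -> W) (x v : V) (l : W) : f x = g x ->
  (exists2 d : R, 0 < d &
    forall t, 0 < t < d -> f (x + t *: v) = g (x + t *: v)) ->
  gateaux_quotient g x v t @[t --> 0^'+] --> l ->
  gateaux_quotient f x v t @[t --> 0^'+] --> l.
Proof.
move=> fgx [d d0 fg]; apply: cvg_trans; apply: near_eq_cvg.
near=> t; rewrite /gateaux_quotient fgx fg//; apply/andP; split.
  by near: t; exact: nbhs_right_gt.
by near: t; exact: nbhs_right_lt.
Unshelve. all: by end_near. Qed.

Lemma gateaux_quotient_id (x v : V) :
  gateaux_quotient id x v t @[t --> 0^'+] --> v.
Proof.
apply: cvg_near_cst; near=> t; rewrite /gateaux_quotient addrC addKr scalerK//.
Unshelve. all: by end_near. Qed.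

Lemma gateaux_derive_cvg (f : V -> W) (x v : V) (l : W) :
  gateaux_quotient f x v t @[t --> 0^'+] --> l ->
  gateaux_derivable f x v /\ gateaux_derive f x v = l.
Proof.
move=> fl; split; first by apply/cvg_ex; exists l.
exact: (cvg_lim (@norm_hausdorff _ W)) fl.
Qed.

Lemma is_diff_linear (f : {linear V -> W}) (x : V) : continuous f ->
  is_diff x f f.
Proof.
by move=> fc; apply: DiffDef; [exact: linear_differentiable|rewrite diff_lin].
Qed.

End NormedSpace.

(** * The sequence space l_p *)

Section SequenceNorm.
Context {R : realType} (p : R) (hp : 1 < p).
Implicit Types (x y : lp hp) (M : set nat).

Let p_gt0 : 0 < p. Proof. exact: lt_trans hp. Qed.

(** Removing the root turns norm estimates into termwise comparisons of extended-real series. *)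
Lemma lpnorm_powE x :
  (`|x| `^ p)%:E = (\sum_(k <oo) (`|lp_coord x k| `^ p)%:E)%E.
Proof.
have S_ge0 : (0 <= \sum_(k <oo) (`|lp_coord x k| `^ p)%:E)%E.
  by apply: nneseries_ge0 => k _ _; rewrite lee_fin powR_ge0.
rewrite lpnormE -powRrM mulVf ?gt_eqF// powRr1 ?fine_ge0//.
by rewrite fineK// ge0_fin_numE// lp_summable.
Qed.

Lemma lp_coordB x y i : lp_coord (x - y) i = lp_coord x i - lp_coord y i.
Proof. by rewrite lp_coordD -scaleN1r lp_coordZ mulN1r. Qed.

Lemma le_lpnorm x y :
  (forall i, `|lp_coord x i| <= `|lp_coord y i|) -> `|x| <= `|y|.
Proof.
move=> xy; have : `|x| `^ p <= `|y| `^ p.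
  rewrite -lee_fin !lpnorm_powE; apply: lee_nneseries => [k _ _|k _].
    by rewrite lee_fin powR_ge0.
  by rewrite lee_fin ler_powRl// ltW.
have pV0 : 0 <= p^-1 by rewrite invr_ge0 ltW.
move=> /(ler_powRl pV0 (powR_ge0 _ _)).
by rewrite -!powRrM !divff ?gt_eqF// !powRr1.
Qed.

(** Strict convexity of the norm: midpoint convexity of the [p]-th power is summed over the
    coordinates, and it is strict at any coordinate where [x] and [y] differ. *)
Lemma lp_midpoint_lt x y d : `|x| <= d -> `|y| <= d -> x != y ->
  `|2^-1 *: (x + y)| < d.
Proof.
move=> xd yd xy; rewrite ltNge; apply/negP => dm.
have [i xyi] : exists i, lp_coord x i != lp_coord y i.
  apply/not_existsP => h; move/eqP: xy; apply; apply: lp_ext => i.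
  by have /negP := h i; rewrite negbK => /eqP.
set m := 2^-1 *: (x + y) in dm.
have mE k : lp_coord m k = (lp_coord x k + lp_coord y k) / 2.
  by rewrite lp_coordZ lp_coordD mulrC.
pose a k : R := (`|lp_coord x k| `^ p + `|lp_coord y k| `^ p) / 2.
have a0 k : 0 <= a k by rewrite divr_ge0// addr_ge0 ?powR_ge0.
have d0 : 0 <= d by apply: le_trans xd.
have aE : (\sum_(k <oo) (a k)%:E = ((`|x| `^ p + `|y| `^ p) / 2)%:E)%E.
  rewrite mulrC EFinM EFinD !lpnorm_powE -nneseriesD//.
  rewrite -nneseriesZl; last by move=> k _; rewrite lee_fin addr_ge0 ?powR_ge0.
  by apply: eq_eseriesr => k _; rewrite -EFinD -EFinM mulrC.
have : (\sum_(k <oo) (`|lp_coord m k| `^ p)%:E < \sum_(k <oo) (a k)%:E)%E.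
  have le k : `|lp_coord m k| `^ p <= a k.
    rewrite mE /a; have [->|xyk] := eqVneq (lp_coord x k) (lp_coord y k).
      have half (u : R) : (u + u) / 2 = u by lra.
      by rewrite !half.
    exact/ltW/powR_midpoint_norm.
  have term_ge0 k : (0 <= (`|lp_coord m k| `^ p)%:E)%E.
    by rewrite lee_fin powR_ge0.
  have a_ge0 k : (0 <= (a k)%:E)%E by rewrite lee_fin.
  (* The strict coordinate [i] is split off; strictness survives the addition because the remaining
     sum is finite. *)
  rewrite [ltLHS](@nneseriesD1 _ _ i xpredT)//.
  rewrite [ltRHS](@nneseriesD1 _ _ i xpredT)//.
  apply: lte_leD.
  - rewrite ge0_fin_numE; last exact: nneseries_ge0.
    apply: le_lt_trans (lp_summable m).
    by rewrite [leRHS](@nneseriesD1 _ _ i xpredT)// leeDr.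
  - by rewrite lte_fin mE; exact: powR_midpoint_norm.
  - by apply: lee_nneseries => // k _; rewrite lee_fin.
rewrite -lpnorm_powE aE lte_fin ltNge => /negP; apply.
have := ler_powRl (ltW p_gt0) d0 dm.
have := ler_powRl (ltW p_gt0) (normr_ge0 _) xd.
have := ler_powRl (ltW p_gt0) (normr_ge0 _) yd.
lra.
Qed.

Lemma restr_coord M x i :
  lp_coord (restr M x) i = if i \in M then lp_coord x i else 0.
Proof. by rewrite -[LHS]/((lp_coord x \_ M) i) patchE. Qed.

Lemma restr_is_linear M : linear (@restr R p hp M).
Proof.
move=> a x y; apply: lp_ext => i.
rewrite lp_coordD lp_coordZ !restr_coord.
by case: ifP => _; rewrite ?lp_coordD ?lp_coordZ// mulr0 addr0.
Qed.

HB.instance Definition _ M :=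
  GRing.isLinear.Build R (lp hp) (lp hp) _ (restr M) (@restr_is_linear M).

Lemma restr_id M x : restr M (restr M x) = restr M x.
Proof.
by apply: lp_ext => i; rewrite !restr_coord; case: (i \in M).
Qed.

Lemma restr_restrC M x : restr M (restr (~` M) x) = 0.
Proof.
apply: lp_ext => i; rewrite !restr_coord in_setC.
by case: (i \in M).
Qed.

Lemma restr_decomp M x : restr M x + restr (~` M) x = x.
Proof.
apply: lp_ext => i; rewrite lp_coordD !restr_coord in_setC.
by case: (i \in M); rewrite ?addr0 ?add0r.
Qed.

Lemma norm_restr_le M x : `|restr M x| <= `|x|.
Proof.
apply: le_lpnorm => // i; rewrite restr_coord.
by case: ifP => // _; rewrite normr0.
Qed.

Lemma restr_continuous M : continuous (@restr R p hp M).
Proof.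
apply: (@lipschitz_linear_continuous _ _ _ _ 1) => x.
by rewrite mul1r norm_restr_le.
Qed.

End SequenceNorm.

(** * Hölder's inequality and the pairing of l_q with l_p *)

Lemma nneseries_le_series_cvg (R : realType) (f : nat -> R) (B : R) :
  (forall i, 0 <= f i) -> (\sum_(k <oo) (f k)%:E <= B%:E)%E ->
  cvgn (series f) /\ limn (series f) <= B.
Proof.
move=> f0 fB.
have serB n : series f n <= B.
  rewrite /series/= -lee_fin -sumEFin (le_trans _ fB)//.
  by apply: nneseries_lim_ge => k _ _; rewrite lee_fin.
have cf : cvgn (series f).
  apply: nondecreasing_is_cvgn; first exact: nondecreasing_series.
  by exists B => _ [n _ <-].
by split=> //; apply: limr_le => //; exact: nearW.
Qed.

Lemma limn_series_nneseries (R : realType) (f : nat -> R) (B : R) :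
  (forall i, 0 <= f i) -> (\sum_(k <oo) (f k)%:E = B%:E)%E ->
  limn (series f) = B.
Proof.
move=> f0 fB.
have [|cf _] := @nneseries_le_series_cvg _ f B f0; first by rewrite fB.
apply: EFin_inj; rewrite -EFin_lim// -fB; congr (limn _).
by apply/funext => n /=; rewrite sumEFin.
Qed.

Section Pairing.
Context {R : realType} (p q : R) (hp : 1 < p) (hq : 1 < q).
Hypothesis hpq : p^-1 + q^-1 = 1.
Implicit Types (x : lp hp) (y : lp hq).

(** Hölder's inequality for the counting measure, with the norm of exponent 1 unfolded to a sum. It
    yields both the absolute convergence of the pairing and its bound. *)
Lemma lp_hoelder y x :
  (\sum_(k <oo) (`|lp_coord y k * lp_coord x k|)%:E <= (`|y| * `|x|)%:E)%E.
Proof.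
have p0 : 0 < p by exact: lt_trans hp.
have q0 : 0 < q by exact: lt_trans hq.
have meas (f : nat -> R) : measurable_fun setT f by [].
have := @hoelder _ _ _ (@counting nat R) _ _ q p (meas (lp_coord y))
  (meas (lp_coord x)) q0 p0.
rewrite addrC => /(_ hpq); rewrite Lnorm_counting// invr1.
rewrite poweRe1; last by apply: nneseries_ge0 => k _ _; exact: poweR_ge0.
rewrite EFinM.
have nE (s : R) (hs : 1 < s) (z : lp hs) :
    (`|z|%:E = 'N[@counting nat R]_(s%:E)[EFin \o lp_coord z])%E.
  by rewrite -[LHS]/((lpnorm z)%:E) /lpnorm finite_norm_fine.
rewrite !nE; apply: le_trans; apply: lee_nneseries => // k _ /=.
by rewrite powRr1.
Qed.

Let term y x := fun i => lp_coord y i * lp_coord x i.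

Lemma cvg_norm_pairing y x : cvgn [normed series (term y x)] /\
  limn [normed series (term y x)] <= `|y| * `|x|.
Proof.
apply: nneseries_le_series_cvg => [i|]; first exact: normr_ge0.
exact: lp_hoelder.
Qed.

Lemma cvg_pairing y x : cvgn (series (term y x)).
Proof. by apply: normed_cvg; have [] := cvg_norm_pairing y x. Qed.

Lemma norm_pairing_le y x : `|pairing y x| <= `|y| * `|x|.
Proof.
have [cN leN] := cvg_norm_pairing y x.
by apply: le_trans leN; exact: lim_series_norm.
Qed.

Lemma pairing_linearr y : linear (pairing y : lp hp -> R).
Proof.
move=> a u v; rewrite /pairing.
rewrite (_ : (fun i => _) = a *: term y u + term y v); last first.
  apply/funext => i; rewrite /term lp_coordD lp_coordZ mulrDr mulrCA.
  by [].
rewrite lim_seriesD; last 2 first.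
- by apply: is_cvg_seriesZ; exact: cvg_pairing.
- exact: cvg_pairing.
by rewrite lim_seriesZ//; exact: cvg_pairing.
Qed.

Lemma pairing_linearl x : linear ((fun y => pairing y x) : lp hq -> R).
Proof.
move=> a u v; rewrite /pairing.
rewrite (_ : (fun i => _) = a *: term u x + term v x); last first.
  apply/funext => i; rewrite /term lp_coordD lp_coordZ mulrDl -mulrA.
  by [].
rewrite lim_seriesD; last 2 first.
- by apply: is_cvg_seriesZ; exact: cvg_pairing.
- exact: cvg_pairing.
by rewrite lim_seriesZ//; exact: cvg_pairing.
Qed.

End Pairing.

(** * The derivative of the l_p norm *)

Section NormDerivative.
Context {R : realType} (p q : R) (hp : 1 < p) (hq : 1 < q).
Hypothesis hpq : p^-1 + q^-1 = 1.
Implicit Types (x y u : lp hp).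

Let p_gt0 : 0 < p. Proof. exact: lt_trans hp. Qed.
Let q_gt0 : 0 < q. Proof. exact: lt_trans hq. Qed.
Let pB1_neq0 : p - 1 != 0. Proof. by rewrite gt_eqF// subr_gt0. Qed.
Let norm_sgpow_q (a : R) : `|sgpow (p - 1) a| `^ q = `|a| `^ p.
Proof. by rewrite norm_sgpow// -powRrM conjugate_exponentM. Qed.

Lemma mazur_summable x :
  (\sum_(k <oo) (`|sgpow (p - 1) (lp_coord x k)| `^ q)%:E < +oo)%E.
Proof. by under eq_eseriesr do rewrite norm_sgpow_q; exact: lp_summable. Qed.

(** The Mazur map, that is, the duality mapping without its normalizing factor. *)
Definition mazur x : lp hq := mk_lp hq (mazur_summable x).

Lemma norm_mazur x : `|mazur x| `^ q = `|x| `^ p.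
Proof.
apply: EFin_inj; rewrite !lpnorm_powE.
by apply: eq_eseriesr => k _; rewrite lp_coord_mk_lp norm_sgpow_q.
Qed.

(** [sgpow_sub_le] is summed over the coordinates. Its small parameter is fixed first, so that the
    term in [|x|] takes half of [e ^ q]; the resulting [C] then determines how close [y] must be for
    the other half. *)
Lemma mazur_continuous : continuous mazur.
Proof.
move=> x; apply: norm_lt_continuous => e e0.
have eq0 : 0 < e `^ q by rewrite powR_gt0.
set s := `|x| `^ p + 1.
have s0 : 0 < s by rewrite ltr_wpDl ?powR_ge0.
have e'0 : 0 < e `^ q / 2 / s by rewrite !divr_gt0.
have [C C0 hC] := sgpow_sub_le hp hq hpq e'0.
have c0 : 0 < e `^ q / 2 / C by rewrite !divr_gt0.
exists ((e `^ q / 2 / C) `^ p^-1); first by rewrite powR_gt0.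
move=> y yd.
have : `|mazur y - mazur x| `^ q <=
    (e `^ q / 2 / s) * `|x| `^ p + C * `|y - x| `^ p.
  rewrite -lee_fin EFinD !EFinM !lpnorm_powE.
  rewrite -!nneseriesZl// -nneseriesD//; last 2 first.
  - by move=> k _ _; rewrite mule_ge0// lee_fin ?powR_ge0 ?ltW.
  - by move=> k _ _; rewrite mule_ge0// lee_fin ?powR_ge0 ?ltW.
  apply: lee_nneseries => [k _ _|k _]; first by rewrite lee_fin powR_ge0.
  by rewrite !lp_coordB !lp_coord_mk_lp -!EFinM -EFinD lee_fin.
have : C * `|y - x| `^ p < e `^ q / 2.
  rewrite mulrC -ltr_pdivlMr// -[ltRHS](@powRVK _ p) ?gt_eqF ?(ltW c0)//.
  by rewrite gt0_ltr_powR// nnegrE ?powR_ge0.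
have : e `^ q / 2 / s * `|x| `^ p <= e `^ q / 2.
  by rewrite -mulrA ger_pMr ?divr_gt0// mulrC ler_pdivrMr// mul1r lerDl.
move=> h1 h2 h3.
have : `|mazur y - mazur x| `^ q < e `^ q by lra.
by apply: contraTT; rewrite -!leNgt => /(ler_powRl (ltW q_gt0) (ltW e0)).
Qed.

Lemma pairing_mazur x : pairing (mazur x) x = `|x| `^ p.
Proof.
apply: limn_series_nneseries => [i|].
  rewrite lp_coord_mk_lp /sgpow -mulrA -normrEsg.
  by rewrite mulr_ge0 ?powR_ge0.
rewrite lpnorm_powE; apply: eq_eseriesr => k _.
by rewrite lp_coord_mk_lp /sgpow -mulrA -normrEsg mulrC mulr_powRB1.
Qed.

(** For [x != 0] this is [J x / |x|] (see [J_norm_grad]), the unit functional that attains the norm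
    at [x]. *)
Definition norm_grad x : lp hq := `|x| `^ (1 - p) *: mazur x.

Lemma norm_norm_grad x : x != 0 -> `|norm_grad x| = 1.
Proof.
move=> x0; have nx : 0 < `|x| by rewrite normr_gt0.
(* [norm_mazur] gives only the [q]-th power of the norm; there the exponents [(1 - p) * q] and [p]
   of [|x|] cancel. *)
have -> : `|norm_grad x| = (`|norm_grad x| `^ q) `^ q^-1.
  by rewrite -powRrM divff ?gt_eqF// powRr1.
rewrite normrZ ger0_norm ?powR_ge0// powRM ?powR_ge0// norm_mazur.
rewrite -powRrM -opprB mulNr conjugate_exponentM// -powRD; last first.
  by rewrite (gt_eqF nx) implybT.
by rewrite addNr powRr0 powR1.
Qed.

Lemma pairingZl a (f : lp hq) x : pairing (a *: f) x = a * pairing f x.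
Proof. exact: (GRing.scalable_linear (pairing_linearl hpq x)). Qed.

Lemma pairingBl (f g : lp hq) x : pairing (f - g) x = pairing f x - pairing g x.
Proof. exact: (GRing.zmod_morphism_linear (pairing_linearl hpq x)). Qed.

Lemma pairingBr (f : lp hq) x y : pairing f (x - y) = pairing f x - pairing f y.
Proof. exact: (GRing.zmod_morphism_linear (pairing_linearr hpq f)). Qed.

Lemma pairing_norm_grad x : x != 0 -> pairing (norm_grad x) x = `|x|.
Proof.
move=> x0; rewrite pairingZl pairing_mazur -powRD; last first.
  by rewrite normr_eq0 x0 implybT.
by rewrite subrK powRr1.
Qed.

Lemma J_norm_grad x : x != 0 -> J hq hpq x = `|x| *: norm_grad x.
Proof.
move=> x0; apply: lp_ext => i; rewrite lp_coord_mk_lp !lp_coordZ lp_coord_mk_lp.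
rewrite /J_seq -/(sgpow _ _) mulrA mulrC; congr (_ * _).
have -> : `|x| * `|x| `^ (1 - p) = `|x| `^ (1 + (1 - p)).
  rewrite [RHS]powRD; last by rewrite normr_eq0 x0 implybT.
  by rewrite powRr1.
by rewrite -powRN; congr (_ `^ _); ring.
Qed.

Lemma norm_grad_continuous x : x != 0 -> {for x, continuous norm_grad}.
Proof.
move=> x0; apply: continuous_scale; last exact: mazur_continuous.
apply: (@continuous_comp _ _ _ (fun y : lp hp => `|y|) (@powR R ^~ (1 - p))).
  exact: norm_continuous.
by apply: powR_continuous; rewrite normr_gt0.
Qed.

(** With [pairing_norm_grad], this is the subgradient inequality of the norm at [x]. *)
Lemma norm_grad_le x y : x != 0 -> pairing (norm_grad x) y <= `|y|.
Proof.
move=> x0; apply: le_trans (ler_norm _) _.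
by rewrite (le_trans (norm_pairing_le hpq _ _))// norm_norm_grad// mul1r.
Qed.

(* [norm_grad x] is a subgradient of the norm at [x]; comparing the subgradient
   inequalities at [x] and at [y] bounds the remainder by
   [`|norm_grad y - norm_grad x| * `|y - x|]. *)
Lemma is_diff_lpnorm x : x != 0 ->
  is_diff x (fun y : lp hp => `|y|) (pairing (norm_grad x)).
Proof.
move=> x0.
pose L : {linear lp hp -> R} := HB.pack (@pairing R p q hp hq (norm_grad x))
  (GRing.isLinear.Build R (lp hp) R _ (@pairing R p q hp hq (norm_grad x))
     (pairing_linearr hpq (norm_grad x))).
apply: (@is_diff_norm_le _ _ _ _ L).
  by apply: (@lipschitz_linear_continuous _ _ _ L) => u; exact: norm_pairing_le.
move=> e e0.
have [d d0 hd] := continuous_norm_lt (norm_grad_continuous x0) e0.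
(* The bound by [|x|] keeps [y] away from [0], so that [norm_grad y] is a subgradient as well. *)
exists (Num.min d `|x|); first by rewrite lt_min d0 normr_gt0.
move=> y; rewrite lt_min => /andP[yd yx].
have y0 : y != 0.
  by apply: contraTneq yx => ->; rewrite sub0r normrN ltxx.
rewrite /L/= pairingBr pairing_norm_grad// opprB addrA subrK.
have lower := norm_grad_le y x0.
rewrite ger0_norm ?subr_ge0//.
apply: (@le_trans _ _ (pairing (norm_grad y - norm_grad x) (y - x))).
  rewrite pairingBl !pairingBr !pairing_norm_grad//.
  move: (norm_grad_le x y0).
  move: (pairing _ x) (pairing _ y) `|x| `|y| => a b c n ac.
  have -> : n - a - (b - c) = n - b + (c - a) by ring.
  by rewrite lerDl subr_ge0.
apply: le_trans (ler_norm _) _; apply: le_trans (norm_pairing_le hpq _ _) _.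
by rewrite ler_wpM2r// ltW// hd.
Qed.

End NormDerivative.

(** * Projection onto the cylinder *)

Section CylinderProjection.
Context {R : realType} (p : R) (hp : 1 < p) (M : set nat) (r : R).
Hypothesis r0 : 0 < r.
Implicit Types x y z u v : lp hp.

Let N x := `|restr M x|.

Lemma norm_restrZ a x : 0 <= a -> N (a *: x) = a * N x.
Proof. by move=> a0; rewrite /N linearZ normrZ ger0_norm. Qed.

Lemma norm_restr_continuous : continuous N.
Proof.
move=> x; apply: (@continuous_comp _ _ _ (@restr R p hp M) Num.norm).
  exact: restr_continuous.
exact: norm_continuous.
Qed.

Lemma boundary_cyl : boundary (@cyl R p hp M r) = [set x | N x = r].
Proof. exact: boundary_sublevel norm_restr_continuous r0 norm_restrZ. Qed.

Lemma cyl_midpoint x y : cyl M r x -> cyl M r y -> cyl M r (2^-1 *: (x + y)).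
Proof.
rewrite /cyl/= => xC yC; rewrite -/(N _) norm_restrZ ?invr_ge0//.
rewrite ler_pdivrMl// mulr2n mulrDl mul1r /N linearD/=.
by apply: le_trans (ler_normD _ _) _; apply: lerD.
Qed.

(** The midpoint of two distinct nearest points would lie in the convex cylinder and be strictly
    closer to [x]. *)
Lemma nearest_cyl_unique x y z : nearest (cyl M r) x y ->
  nearest (cyl M r) x z -> y = z.
Proof.
move=> [yC ymin] [zC zmin]; apply/eqP/negPn/negP => yz.
have xyz : x - y != x - z by apply: contra yz => /eqP/addrI/oppr_inj ->.
have := lp_midpoint_lt (lexx _) (zmin _ yC) xyz.
have -> : 2^-1 *: (x - y + (x - z)) = x - 2^-1 *: (y + z).
  rewrite addrACA -opprD scalerBr; congr (_ - _).
  by rewrite -mulr2n -(scaler_nat 2 x) scalerK ?pnatr_eq0.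
by rewrite ltNge ymin//; exact: cyl_midpoint.
Qed.

Lemma metric_proj_nearest x y : nearest (cyl M r) x y ->
  metric_proj (cyl M r) x = y.
Proof.
move=> xy; apply: xget_unique => [|z [xz _]].
  by split=> // z xz; exact: nearest_cyl_unique xy xz.
exact: nearest_cyl_unique xz xy.
Qed.

Lemma metric_proj_in x : cyl M r x -> metric_proj (cyl M r) x = x.
Proof.
move=> xC; apply: metric_proj_nearest; split=> // z _.
by rewrite subrr normr0.
Qed.

Definition cyl_retract x := (r / N x) *: restr M x + restr (~` M) x.

(** The retraction moves [x] by exactly [N x - r], and every [z] in the cylinder satisfies [|x - z|
    >= N (x - z) >= N x - N z >= N x - r]. The case [N x = r] is included for use at boundary
    points. *)
Lemma metric_proj_out x : r <= N x -> metric_proj (cyl M r) x = cyl_retract x.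
Proof.
move=> rx; apply: metric_proj_nearest.
have Nx : 0 < N x by exact: lt_le_trans rx.
have RQ : restr M (cyl_retract x) = (r / N x) *: restr M x.
  by rewrite linearD linearZ/= restr_id restr_restrC addr0.
split=> [|z zC].
  rewrite /cyl/= RQ normrZ ger0_norm ?divr_ge0 ?(ltW r0) ?(ltW Nx)// -/(N x).
  by rewrite divfK// gt_eqF.
have -> : x - cyl_retract x = (1 - r / N x) *: restr M x.
  rewrite -{1}(restr_decomp M x) /cyl_retract opprD addrACA subrr addr0.
  by rewrite scalerBl scale1r.
rewrite normrZ ger0_norm ?subr_ge0 ?ler_pdivrMr ?mul1r// -/(N x).
rewrite mulrBl mul1r divfK ?gt_eqF//.
apply: (@le_trans _ _ (N (x - z))); last exact: norm_restr_le.
rewrite /N linearB/=; apply: le_trans (lerB_dist _ _).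
by rewrite lerD2l lerN2.
Qed.

(** By convexity of [N], if the ray is in the cylinder at one time [d > 0], it is there at all
    earlier times; otherwise it is outside at every positive time. Hence every direction has a known
    one-sided derivative. *)
Lemma up_dirs_or_down_dirs x v : N x <= r ->
  up_dirs M r x v \/ down_dirs M r x v.
Proof.
move=> xr; have [[d d0 vd]|nd] :=
    pselect (exists2 d, 0 < d & N (x + d *: v) <= r).
  right; exists d; first exact: d0.
  move=> t /andP[t0 td].
  (* The point at time [t] is a convex combination of [x] and the point at time [d]. *)
  have -> : x + t *: v = (1 - t / d) *: x + (t / d) *: (x + d *: v).
    rewrite scalerBl scale1r scalerDr scalerA divfK; last by rewrite gt_eqF.
    by rewrite addrA subrK.
  have td1 : 0 <= 1 - t / d by rewrite subr_ge0 ler_pdivrMr// mul1r ltW.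
  have td0 : 0 <= t / d by rewrite divr_ge0 ?ltW.
  rewrite linearD/=; apply: le_trans (ler_normD _ _) _.
  rewrite -!/(N _) !norm_restrZ//.
  have -> : r = (1 - t / d) * r + t / d * r by ring.
  by rewrite lerD// ler_wpM2l.
left; exists 1 => // t /andP[t0 _]; rewrite ltNge; apply/negP => tr.
by apply: nd; exists t.
Qed.

Lemma metric_proj_gateaux_down x v : N x <= r -> down_dirs M r x v ->
  gateaux_quotient (metric_proj (cyl M r)) x v t @[t --> 0^'+] --> v.
Proof.
move=> xr [d d0 xv].
apply: (@near_gateaux_quotient R (lp hp) (lp hp) _ id).
- exact: metric_proj_in.
- by exists d => // t td; apply: metric_proj_in; exact: xv.
- exact: gateaux_quotient_id.
Qed.

Context (q : R) (hq : 1 < q) (hpq : p^-1 + q^-1 = 1).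

Definition cyl_retract_diff x u :=
  (r / N x) *: (restr M u -
    (pairing (J hq hpq (restr M x)) (restr M u) / N x ^+ 2) *: restr M x)
  + restr (~` M) u.

(** Product rule for the factor [r / N x] and the linear map [restr M]; the factor is differentiated
    by the chain rule through the norm. *)
Lemma is_diff_cyl_retract x : restr M x != 0 ->
  is_diff x cyl_retract (cyl_retract_diff x).
Proof.
move=> x0; have nx : N x != 0 by rewrite normr_eq0.
have dM : is_diff x (@restr R p hp M) (@restr R p hp M).
  apply: (@is_diff_linear R (lp hp) (lp hp) (@restr R p hp M)).
  exact: restr_continuous.
have dC : is_diff x (@restr R p hp (~` M)) (@restr R p hp (~` M)).
  apply: (@is_diff_linear R (lp hp) (lp hp) (@restr R p hp (~` M))).
  exact: restr_continuous.
have dN := is_diff_comp dM (is_diff_lpnorm hq hpq x0).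
have dinv : is_diff (N x) (fun t : R => r / t) (fun h => - r / N x ^+ 2 * h).
  have dV : is_diff (N x) (@GRing.inv R) (fun h => - (N x) ^- 2 *: h).
    by apply: DiffDef; [exact: differentiable_Rinv|rewrite diff_Rinv].
  apply: is_diff_eq (is_diffZ r dV) _; apply/funext => h /=.
  by rewrite !fctE/= /GRing.scale/= mulrA mulrN !mulNr.
have dk := is_diff_comp dN dinv.
apply: is_diff_eq (is_diffD (is_diff_scale dk dM) dC) _.
apply/funext => u; rewrite !fctE/= /cyl_retract_diff; congr (_ + _).
rewrite scalerBr -scaleNr scalerA; congr (_ + _ *: _).
(* [J] carries one more factor [N x] than the gradient, which accounts for the division by
   [N x ^+ 2] in the stated formula. *)
rewrite J_norm_grad// (pairingZl hpq `|restr M x|) -/(N x).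
by field.
Qed.

(** [J] of the [M]-part of [x] pairs with that part to [N x ^+ 2], so the radial component
    cancels. *)
Lemma cyl_retract_diff_id x : restr M x != 0 ->
  cyl_retract_diff x x = restr (~` M) x.
Proof.
move=> x0; have nx : N x != 0 by rewrite normr_eq0.
rewrite /cyl_retract_diff J_norm_grad// (pairingZl hpq `|restr M x|).
by rewrite pairing_norm_grad// -/(N x) -expr2 divff ?expf_neq0// scale1r subrr
  scaler0 add0r.
Qed.

Lemma metric_proj_is_diff_out x : r < N x ->
  is_diff x (metric_proj (cyl M r)) (cyl_retract_diff x).
Proof.
move=> rx; apply: (@near_eq_is_diff _ _ _ _ cyl_retract).
  have : open [set y | r < N y].
    apply: (@open_comp _ _ N [set t | r < t]); last exact: open_gt.
    by move=> y _; exact: norm_restr_continuous.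
  rewrite openE => /(_ _ rx); apply: filterS => y ry.
  exact/metric_proj_out/ltW.
apply: is_diff_cyl_retract; rewrite -normr_gt0; exact: lt_trans rx.
Qed.

Lemma metric_proj_gateaux_up x v : N x = r -> up_dirs M r x v ->
  gateaux_quotient (metric_proj (cyl M r)) x v t @[t --> 0^'+] -->
    cyl_retract_diff x v.
Proof.
move=> xr [d d0 xv].
have [dQ <-] : is_diff x cyl_retract (cyl_retract_diff x).
  by apply: is_diff_cyl_retract; rewrite -normr_gt0 -/(N x) xr.
apply: (@near_gateaux_quotient R (lp hp) (lp hp) _ cyl_retract).
- by apply: metric_proj_out; rewrite xr.
- by exists d => // t td; apply: metric_proj_out; exact/ltW/xv.
- exact: gateaux_quotient_cvg.
Qed.

Lemma up_dirs_self x : N x = r -> up_dirs M r x x.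
Proof.
move=> xr; exists 1; first exact: ltr01.
move=> t /andP[t0 _]; rewrite -{1}[x]scale1r -scalerDl -/(N _).
by rewrite norm_restrZ ?xr ?ltr_pMl ?ltrDl// addr_ge0 ?ltW.
Qed.

Lemma down_dirs_opp x : N x = r -> down_dirs M r x (- x).
Proof.
move=> xr; exists 1; first exact: ltr01.
move=> t /andP[t0 t1]; rewrite scalerN -{1}[x]scale1r -scalerBl -/(N _).
rewrite norm_restrZ ?subr_ge0 ?(ltW t1)// xr.
by rewrite ler_piMl ?gerBl ?(ltW t0) ?(ltW r0).
Qed.

Lemma metric_proj_not_differentiable x : N x = r ->
  ~ differentiable (metric_proj (cyl M r)) x.
Proof.
move=> xr dP; have x0 : restr M x != 0 by rewrite -normr_gt0 -/(N x) xr.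
have up : 'd (metric_proj (cyl M r)) x x = restr (~` M) x.
  rewrite -cyl_retract_diff_id//.
  have [_ <-] := gateaux_derive_cvg (@gateaux_quotient_cvg _ _ _ _ _ x dP).
  have /gateaux_derive_cvg[] := metric_proj_gateaux_up xr (up_dirs_self xr).
  by [].
have down : 'd (metric_proj (cyl M r)) x (- x) = - x.
  have [_ <-] := gateaux_derive_cvg (@gateaux_quotient_cvg _ _ _ _ _ (- x) dP).
  have xr' : N x <= r by rewrite xr.
  have /gateaux_derive_cvg[] := metric_proj_gateaux_down xr' (down_dirs_opp xr).
  by [].
(* Linearity would make [x] equal to its part off [M], whose restriction to [M] is zero, against
   [x0]. *)
move: down; rewrite linearN up => /oppr_inj xE.
by move: x0; rewrite -xE restr_restrC eqxx.
Qed.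

End CylinderProjection.

Theorem theorem4p3 (R : realType) (p q : R) (hp : 1 < p) (hq : 1 < q)
    (hpq : p^-1 + q^-1 = 1) (M : set nat) (hM : M !=set0) (r : R) (hr : 0 < r) :
  let C : set (lp hp) := cyl M r in
  let P : lp hp -> lp hp := metric_proj C in
  [/\ boundary C = [set x | `|restr M x| = r],
      forall x : lp hp, interior C x ->
        exists2 D : {linear lp hp -> lp hp}, strict_diff_at P x D &
          forall u : lp hp, D u = u,
      forall x : lp hp, ~ C x ->
        [/\ differentiable P x,
            forall u : lp hp,
              'd P x u =
                (r / `|restr M x|) *:
                  (restr M u -
                   (pairing (J hq hpq (restr M x)) (restr M u)
                      / `|restr M x| ^+ 2) *: restr M x)
                + restr (~` M) u &
            'd P x x = restr (~` M) x],
      forall x : lp hp, boundary C x ->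
        [/\ gateaux_differentiable P x,
            forall u : lp hp, up_dirs M r x u ->
              gateaux_derive P x u =
                u - (pairing (J hq hpq (restr M x)) (restr M u) / r ^+ 2)
                      *: restr M x,
            gateaux_derive P x x = restr (~` M) x &
            forall u : lp hp, down_dirs M r x u -> gateaux_derive P x u = u] &
      forall x : lp hp, boundary C x -> ~ differentiable P x].
Proof.
move=> C P; have bC : boundary C = [set x | `|restr M x| = r].
  exact: boundary_cyl.
have neq0 x : r <= `|restr M x| -> restr M x != 0.
  by move=> rx; rewrite -normr_gt0 (lt_le_trans hr).
split=> // [x xC|x xC|x|x]; rewrite ?bC.
- exists (idfun : {linear lp hp -> lp hp}) => //.
  apply: near_id_strict_diff; move: xC; rewrite /interior/=.
  by apply: filterS => y; exact: metric_proj_in.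
- have rx : r < `|restr M x| by rewrite ltNge; exact/negP.
  have [dP dPE] := metric_proj_is_diff_out hr hq hpq rx.
  rewrite /P dPE; split=> //; exact/cyl_retract_diff_id/neq0/ltW.
- move=> /= xr; have xr' : `|restr M x| <= r by rewrite xr.
  have up u : up_dirs M r x u -> gateaux_derivable P x u /\
      gateaux_derive P x u = cyl_retract_diff M r hq hpq x u.
    by move=> xu; apply: gateaux_derive_cvg; exact: metric_proj_gateaux_up.
  have down u : down_dirs M r x u -> gateaux_derivable P x u /\
      gateaux_derive P x u = u.
    move=> xu; apply: gateaux_derive_cvg.
    exact: metric_proj_gateaux_down.
  split=> [u _|u /up[_ ->]||u /down[]//].
  + by have [/up[]|/down[]] := @up_dirs_or_down_dirs _ _ hp M r x u xr'.
  (* On the boundary the factor [r / N x] is [1], so the two restrictions of [u] recombine to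
     [u]. *)
  + rewrite /cyl_retract_diff xr divff ?gt_eqF// scale1r.
    by rewrite addrAC restr_decomp.
  + have [_ ->] := up _ (up_dirs_self hr xr).
    by apply: cyl_retract_diff_id; apply: neq0; rewrite xr.
- exact: (metric_proj_not_differentiable hr hq hpq).
Qed.
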